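(* (In $\mathsf{ZF}$.) If $M$ is $H$-like and $X$ is a maximal cardinality of $M$, then $M=H_X$.
   Context: $|X|\lesssim|Y|$ means $X=\emptyset$ or there is a surjection from $Y$ onto $X$. $X\in M$ is a maximal cardinality of $M$ if $M\models\forall Y(|Y|\lesssim|X|)$. $M$ is of successor type if it has a maximal cardinality. $M$ is transitively closed if for each $Y\in M$ there is a transitive $Z\in M$ with $Z\subseteq M$ and $Y\in Z$; closed under products if $X\times Y\in M$ whenever $X,Y\in M$; closed under subsets if $\mathscr{P}(X)\subseteq M$ for every $X\in M$; full if all three hold. $M$ is strongly regular if whenever $X\in M$ and $f:X\to\mathsf{Ord}\cap M$ is any function, the range of $f$ is bounded in $\mathsf{Ord}\cap M$. $M$ is hierarchical if $M$ is transitive and, with $\kappa=\mathsf{Ord}\cap M$, there is a $\subseteq$-increasing continuous sequence $\langle M_\alpha:\alpha<\kappa\rangle$ of transitive sets with $M=\bigcup_{\alpha<\kappa}M_\alpha$ and each $M_\alpha\in M$. A transitive set $M$ is $H$-like if it is full and hierarchical and, if it is of successor type, strongly regular. $H_X$ is the set of all $Y$ such that there is a surjection from $X$ onto the transitive closure of $\{Y\}$. *)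

(* Defs.v *)
Set Implicit Arguments.
Unset Strict Implicit.
Unset Printing Implicit Defensive.

(* Provability in ZF is rendered as truth in every first-order model of ZF.
   Sets are the elements of such a model, and functions, surjections, ordinals
   and sequences are elements of the model too, so no form of choice is
   assumed of them. *)

Record structure : Type := Structure {
  carrier :> Type;
  mem : carrier -> carrier -> Prop
}.

Arguments mem {s} _ _.

Notation "x ∈ y" := (mem x y) (at level 70, no associativity).
Notation "x ∉ y" := (~ mem x y) (at level 70, no associativity).

(* First-order formulas of the language of set theory, with de Bruijn indices:
   under a quantifier, index 0 is the bound variable. *)
Inductive formula : Type :=
| FMem (i j : nat)
| FEq (i j : nat)
| FFalse
| FImp (p q : formula)
| FAnd (p q : formula)
| FOr (p q : formula)
| FAll (p : formula)
| FEx (p : formula).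

Definition scons (T : Type) (x : T) (e : nat -> T) (n : nat) : T :=
  match n with
  | O => x
  | S m => e m
  end.

Fixpoint sat (V : structure) (e : nat -> V) (p : formula) : Prop :=
  match p with
  | FMem i j => e i ∈ e j
  | FEq i j => e i = e j
  | FFalse => False
  | FImp q r => sat e q -> sat e r
  | FAnd q r => sat e q /\ sat e r
  | FOr q r => sat e q \/ sat e r
  | FAll q => forall x : V, sat (scons x e) q
  | FEx q => exists x : V, sat (scons x e) q
  end.

Section Notions.

(* These notions quantify over the whole structure, so that instantiating them
   at [submodel M] below yields their interpretation in [M]. *)
Variable V : structure.
Implicit Types (a b f k p x y z A B L M P S T X Y Z : V).

Definition subset X Y : Prop := forall z, z ∈ X -> z ∈ Y.

Definition is_empty X : Prop := forall z, z ∉ X.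

Definition transitive X : Prop := forall y, y ∈ X -> subset y X.

Definition is_upair p x y : Prop := forall z, z ∈ p <-> z = x \/ z = y.

(* Kuratowski pairs: p = {{x}, {x, y}}. *)
Definition is_opair p x y : Prop :=
  exists a b, is_upair a x x /\ is_upair b x y /\ is_upair p a b.

Definition is_prod P X Y : Prop :=
  forall p, p ∈ P <-> exists x y, x ∈ X /\ y ∈ Y /\ is_opair p x y.

Definition maps f x y : Prop := exists p, p ∈ f /\ is_opair p x y.

Definition is_fun f X Y : Prop :=
  (forall p, p ∈ f -> exists x y, x ∈ X /\ y ∈ Y /\ is_opair p x y) /\
  (forall x, x ∈ X -> exists! y, maps f x y).

Definition is_surj f X Y : Prop :=
  is_fun f X Y /\ forall y, y ∈ Y -> exists x, x ∈ X /\ maps f x y.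

(* |X| ≲ |Y| *)
Definition lesssim X Y : Prop := is_empty X \/ exists f, is_surj f Y X.

Definition ordinal a : Prop :=
  transitive a /\
  (forall x, x ∈ a -> x ∉ x) /\
  (forall x y z, x ∈ a -> y ∈ a -> z ∈ a -> x ∈ y -> y ∈ z -> x ∈ z) /\
  (forall x y, x ∈ a -> y ∈ a -> x ∈ y \/ x = y \/ y ∈ x) /\
  (forall S, subset S a -> ~ is_empty S ->
     exists x, x ∈ S /\ forall y, y ∈ S -> x = y \/ x ∈ y).

Definition limit_ordinal L : Prop :=
  ordinal L /\ ~ is_empty L /\
  forall a, a ∈ L -> exists b, b ∈ L /\ a ∈ b.

(* T is the transitive closure of X. *)
Definition is_tc T X : Prop :=
  subset X T /\ transitive T /\
  forall Z, subset X Z -> transitive Z -> subset T Z.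

(* Membership in the class H_X. *)
Definition in_H X Y : Prop :=
  exists s T f, is_upair s Y Y /\ is_tc T s /\ is_surj f X T.

(* Separation and Replacement are the first-order schemas; the parameters of a
   formula are supplied by the assignment e. *)
Record ZF : Prop := {
  zf_extensionality : forall X Y, (forall z, z ∈ X <-> z ∈ Y) -> X = Y;
  zf_foundation : forall X, ~ is_empty X ->
    exists y, y ∈ X /\ forall z, z ∈ X -> z ∉ y;
  zf_pairing : forall x y, exists p, is_upair p x y;
  zf_union : forall X, exists Y, forall z,
    z ∈ Y <-> exists y, y ∈ X /\ z ∈ y;
  zf_powerset : forall X, exists P, forall z, z ∈ P <-> subset z X;
  zf_infinity : exists X,
    (exists z, is_empty z /\ z ∈ X) /\
    forall x, x ∈ X ->
      exists y, y ∈ X /\ forall z, z ∈ y <-> z ∈ x \/ z = x;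
  zf_separation : forall (phi : formula) (e : nat -> V) X,
    exists Y, forall x, x ∈ Y <-> x ∈ X /\ sat (scons x e) phi;
  zf_replacement : forall (phi : formula) (e : nat -> V) X,
    (forall x y z, x ∈ X ->
       sat (scons x (scons y e)) phi -> sat (scons x (scons z e)) phi ->
       y = z) ->
    exists Y, forall y,
      y ∈ Y <-> exists x, x ∈ X /\ sat (scons x (scons y e)) phi
}.

(* k = Ord ∩ M *)
Definition is_ord_cap k M : Prop := forall a, a ∈ k <-> ordinal a /\ a ∈ M.

Definition transitively_closed M : Prop :=
  forall Y, Y ∈ M ->
    exists Z, transitive Z /\ Z ∈ M /\ subset Z M /\ Y ∈ Z.

Definition closed_under_products M : Prop :=
  forall X Y, X ∈ M -> Y ∈ M -> exists P, is_prod P X Y /\ P ∈ M.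

Definition closed_under_subsets M : Prop :=
  forall X, X ∈ M -> forall Y, subset Y X -> Y ∈ M.

Definition full M : Prop :=
  transitively_closed M /\ closed_under_products M /\ closed_under_subsets M.

Definition strongly_regular M : Prop :=
  exists k, is_ord_cap k M /\
    forall X f, X ∈ M -> is_fun f X k ->
      exists b, b ∈ k /\
        forall x a, x ∈ X -> maps f x a -> a ∈ b \/ a = b.

(* S is the sequence of the M_α, α < k, taken as a function from k to M. *)
Definition hierarchical M : Prop :=
  transitive M /\
  exists k S, is_ord_cap k M /\ is_fun S k M /\
    (forall a A, maps S a A -> transitive A) /\
    (forall a b A B, a ∈ b -> maps S a A -> maps S b B -> subset A B) /\
    (forall L A, limit_ordinal L -> maps S L A ->
       forall x, x ∈ A <-> exists a B, a ∈ L /\ maps S a B /\ x ∈ B) /\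
    (forall x, x ∈ M <-> exists a A, a ∈ k /\ maps S a A /\ x ∈ A).

End Notions.

Definition submodel (V : structure) (M : V) : structure :=
  @Structure {x : V | x ∈ M} (fun x y => proj1_sig x ∈ proj1_sig y).

(* X ∈ M, and M ⊨ ∀ Y (|Y| ≲ |X|). *)
Definition maximal_cardinality (V : structure) (M X : V) : Prop :=
  exists XM : X ∈ M,
    forall Y : submodel M, lesssim Y (exist _ X XM : submodel M).

Definition successor_type (V : structure) (M : V) : Prop :=
  exists X : V, maximal_cardinality M X.

Definition H_like (V : structure) (M : V) : Prop :=
  transitive M /\ full M /\ hierarchical M /\
  (successor_type M -> strongly_regular M).

(* Main.v *)
Require Import Defs.
From Stdlib Require Import Classical.

(** If [Y ∈ M], the transitive closure of [{Y}] is a subset of an element of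
    [M], hence lies in [M], and the surjection from [X] that [M] provides is a
    surjection in [V] because [M] is transitive.

    Conversely let [f] be a surjection from [X] onto the transitive closure [T]
    of [{Y}], and let [y ∈ T] be ∈-minimal outside [M]. Then [y ⊆ M]. Sending
    each [x ∈ X] with [f x ∈ y] to the least [a] with [f x ∈ M_a] is a function
    from an element of [M] to [Ord ∩ M]. By strong regularity it is bounded by
    some [b], so [y ⊆ M_b ∈ M] and [y ∈ M]. Taking least indices is what makes
    the axiom of choice unnecessary. *)

Set Implicit Arguments.
Unset Strict Implicit.
Unset Printing Implicit Defensive.

(** * Definable predicates *)

(** Semantic stand-in for a formula: an instance of a schema can be written as an ordinary predicate
    on assignments, the de Bruijn formula being recovered by [prove_definable]. *)
Definition definable (V : structure) (P : (nat -> V) -> Prop) : Prop :=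
  exists phi, forall e, sat e phi <-> P e.

Section Definability.

Variable V : structure.
Implicit Types (P Q : (nat -> V) -> Prop) (R : V -> (nat -> V) -> Prop).

Lemma definable_mem i j : definable (fun e : nat -> V => e i ∈ e j).
Proof. exists (FMem i j); intro e; reflexivity. Qed.

Lemma definable_eq i j : definable (fun e : nat -> V => e i = e j).
Proof. exists (FEq i j); intro e; reflexivity. Qed.

Lemma definable_false : definable (fun _ : nat -> V => False).
Proof. exists FFalse; intro e; reflexivity. Qed.

Lemma definable_imp P Q :
  definable P -> definable Q -> definable (fun e => P e -> Q e).
Proof.
  intros [p Hp] [q Hq]; exists (FImp p q); intro e; simpl.
  rewrite (Hp e), (Hq e); reflexivity.
Qed.

Lemma definable_and P Q :
  definable P -> definable Q -> definable (fun e => P e /\ Q e).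
Proof.
  intros [p Hp] [q Hq]; exists (FAnd p q); intro e; simpl.
  rewrite (Hp e), (Hq e); reflexivity.
Qed.

Lemma definable_or P Q :
  definable P -> definable Q -> definable (fun e => P e \/ Q e).
Proof.
  intros [p Hp] [q Hq]; exists (FOr p q); intro e; simpl.
  rewrite (Hp e), (Hq e); reflexivity.
Qed.

(** The premise reads the bound variable at index 0 and shifts the others. At [scons x e] it reduces
    by computation and eta to [R x e], so the satisfaction clause applies directly. *)
Lemma definable_all R :
  definable (fun e => R (e 0) (fun n => e (S n))) ->
  definable (fun e => forall x, R x e).
Proof.
  intros [p Hp]; exists (FAll p); intro e; simpl.
  split; intros H x; exact (proj1 (Hp (scons x e)) (H x)) ||
    exact (proj2 (Hp (scons x e)) (H x)).
Qed.

Lemma definable_ex R :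
  definable (fun e => R (e 0) (fun n => e (S n))) ->
  definable (fun e => exists x, R x e).
Proof.
  intros [p Hp]; exists (FEx p); intro e; simpl.
  split; intros [x H]; exists x; exact (proj1 (Hp (scons x e)) H) ||
    exact (proj2 (Hp (scons x e)) H).
Qed.

End Definability.

(** Recursion on the shape of the predicate, after unfolding to membership and equality.
    [definable_imp] is tried before [definable_all] because both goals are products; it fails on a
    dependent one. *)
Ltac prove_definable :=
  unfold maps, is_opair, is_upair, transitive, subset, iff, not;
  repeat (cbv beta;
    lazymatch goal with
    | |- definable (fun _ => False) => apply definable_false
    | |- definable (fun _ => _ /\ _) => apply definable_and
    | |- definable (fun _ => _ \/ _) => apply definable_or
    | |- definable (fun _ => exists _, _) => apply definable_ex
    | |- definable (fun _ => mem _ _) => apply definable_mem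
    | |- definable (fun _ => _ = _) => apply definable_eq
    | |- definable (fun _ => forall _, _) =>
        first [apply definable_imp | apply definable_all]
    end).

(** * Sets in a model of ZF *)

Section Model.

Variable V : structure.
Hypothesis HV : ZF V.
Implicit Types (a b f k p s t x y z A B M S T X Y Z : V).

Lemma separation (P : (nat -> V) -> Prop) (e : nat -> V) X :
  definable P ->
  exists Y, forall x, x ∈ Y <-> x ∈ X /\ P (scons x e).
Proof.
  intros [p Hp]; destruct (zf_separation HV p e X) as [Y HY]; exists Y.
  intro x; rewrite (HY x), (Hp (scons x e)); reflexivity.
Qed.

Lemma replacement (P : (nat -> V) -> Prop) (e : nat -> V) X :
  definable P ->
  (forall x y z, x ∈ X ->
     P (scons x (scons y e)) -> P (scons x (scons z e)) -> y = z) ->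
  exists Y, forall y, y ∈ Y <-> exists x, x ∈ X /\ P (scons x (scons y e)).
Proof.
  intros [p Hp] Hfun; destruct (zf_replacement HV (phi := p) (e := e) (X := X))
    as [Y HY].
  - intros x y z Hx H1 H2; apply (Hfun x y z Hx); apply Hp; assumption.
  - exists Y; intro y; rewrite (HY y).
    split; intros [x [Hx H]]; exists x; (split; [exact Hx | apply Hp, H]).
Qed.

Lemma upair_inj p x y x' y' :
  is_upair p x y -> is_upair p x' y' ->
  (x = x' /\ y = y') \/ (x = y' /\ y = x').
Proof.
  intros H H'.
  destruct (proj1 (H' x) (proj2 (H x) (or_introl eq_refl)));
  destruct (proj1 (H' y) (proj2 (H y) (or_intror eq_refl)));
  destruct (proj1 (H x') (proj2 (H' x') (or_introl eq_refl)));
  destruct (proj1 (H y') (proj2 (H' y') (or_intror eq_refl)));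
  subst; auto.
Qed.

Lemma upair_unique p q x y : is_upair p x y -> is_upair q x y -> p = q.
Proof.
  intros Hp Hq; apply (zf_extensionality HV); intro z.
  rewrite (Hp z), (Hq z); reflexivity.
Qed.

Lemma opair_inj p x y x' y' :
  is_opair p x y -> is_opair p x' y' -> x = x' /\ y = y'.
Proof.
  intros (a & b & Ha & Hb & Hp) (a' & b' & Ha' & Hb' & Hp').
  destruct (upair_inj Hp Hp') as [[-> ->] | [-> ->]].
  - destruct (upair_inj Ha Ha') as [[-> _] | [-> _]];
      destruct (upair_inj Hb Hb') as [[_ ->] | [-> ->]]; auto.
  - destruct (upair_inj Ha Hb') as [[? ?] | [? ?]];
      destruct (upair_inj Hb Ha') as [[? ?] | [? ?]]; subst; auto.
Qed.

Lemma opair_unique p q x y : is_opair p x y -> is_opair q x y -> p = q.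
Proof.
  intros (a & b & Ha & Hb & Hp) (a' & b' & Ha' & Hb' & Hq).
  rewrite <- (upair_unique Ha Ha'), <- (upair_unique Hb Hb') in Hq.
  exact (upair_unique Hp Hq).
Qed.

Lemma opair_exists x y : exists p, is_opair p x y.
Proof.
  destruct (zf_pairing HV x x) as [a Ha], (zf_pairing HV x y) as [b Hb].
  destruct (zf_pairing HV a b) as [p Hp]; exists p, a, b; auto.
Qed.

Lemma maps_mem f X Y x y : is_fun f X Y -> maps f x y -> x ∈ X /\ y ∈ Y.
Proof.
  intros [Hf _] (p & Hp & Hxy).
  destruct (Hf p Hp) as (x' & y' & Hx & Hy & Hxy').
  destruct (opair_inj Hxy Hxy') as [-> ->]; auto.
Qed.

Lemma maps_unique f X Y x y z : is_fun f X Y -> maps f x y -> maps f x z -> y = z.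
Proof.
  intros Hf Hy Hz; destruct (maps_mem Hf Hy) as [Hx _].
  destruct (proj2 Hf x Hx) as (w & _ & Hw).
  rewrite <- (Hw y Hy), <- (Hw z Hz); reflexivity.
Qed.

Lemma opair_components_mem M p x y :
  transitive M -> p ∈ M -> is_opair p x y -> x ∈ M /\ y ∈ M.
Proof.
  intros HM Hp (a & b & Ha & Hb & Hab).
  assert (HbM : b ∈ M) by (apply (HM p Hp), Hab; auto).
  split; apply (HM b HbM), Hb; auto.
Qed.

(** The intersection of all transitive supersets of [X], carved out of [Z] by separation. This
    avoids recursion along the natural numbers and also bounds the closure by [Z]. *)
Lemma tc_exists X Z : transitive Z -> subset X Z -> exists T, is_tc T X /\ subset T Z.
Proof.
  intros HZ HXZ.
  destruct (separation
    (P := fun e => forall W, subset (e 1) W -> transitive W -> e 0 ∈ W)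
    (fun _ => X) Z) as [T HT]; [prove_definable |].
  exists T; repeat split.
  - intros z Hz; apply HT; split; [auto |]; intros W HW _; apply HW, Hz.
  - intros y Hy z Hz; apply HT in Hy; destruct Hy as [HyZ Hy]; apply HT; split.
    + exact (HZ y HyZ z Hz).
    + intros W HXW HW; exact (HW y (Hy W HXW HW) z Hz).
  - intros W HXW HW z Hz; apply HT in Hz; exact (proj2 Hz W HXW HW).
  - intros z Hz; apply HT in Hz; exact (proj1 Hz).
Qed.

(** * Ordinals *)

(** If [c] is a proper initial segment, an ∈-minimal element [m] of the difference [a \ c] has
    exactly the members of [c], so [c = m ∈ a]. *)
Lemma ordinal_initial_segment a c :
  ordinal a -> subset c a ->
  (forall x y, x ∈ c -> y ∈ a -> y ∈ x -> y ∈ c) ->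
  c = a \/ c ∈ a.
Proof.
  intros (Htr & _ & _ & Htri & _) Hca Hc.
  destruct (classic (c = a)) as [-> | Hne]; [left; reflexivity | right].
  destruct (separation (P := fun e => ~ (e 0 ∈ e 1)) (fun _ => c) a) as [D HD];
    [prove_definable |].
  destruct (zf_foundation HV (X := D)) as (m & Hm & Hmin).
  { intro HDe; apply Hne, (zf_extensionality HV); intro z; split; [apply Hca |].
    intro Hz; apply NNPP; intro Hzc; apply (HDe z), HD; split; assumption. }
  apply HD in Hm; simpl in Hm; destruct Hm as [Hma Hmc].
  replace c with m; [exact Hma |].
  apply (zf_extensionality HV); intro z; split; intro Hz.
  - apply NNPP; intro Hzc; refine (Hmin z _ Hz).
    apply HD; split; [exact (Htr m Hma z Hz) | exact Hzc].
  - destruct (Htri z m (Hca z Hz) Hma) as [H | [-> | H]]; [exact H | |];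
      exfalso; apply Hmc; [exact Hz | exact (Hc z m Hz Hma H)].
Qed.

(** The intersection [c] of [a] and [b] is an initial segment of both. It cannot be a member of
    both, since then [c ∈ c]. *)
Lemma ordinal_trichotomy a b : ordinal a -> ordinal b -> a ∈ b \/ a = b \/ b ∈ a.
Proof.
  intros Ha Hb.
  destruct (separation (P := fun e => e 0 ∈ e 1) (fun _ => b) a) as [c Hc];
    [prove_definable |]; simpl in Hc.
  destruct (ordinal_initial_segment (a := a) (c := c)) as [Eca | Hca].
  - exact Ha.
  - intros z Hz; apply Hc, Hz.
  - intros x y Hx Hy Hyx; apply Hc; split; [exact Hy |].
    exact (proj1 Hb x (proj2 (proj1 (Hc x) Hx)) y Hyx).
  - destruct (ordinal_initial_segment (a := b) (c := c)) as [Ecb | Hcb];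
      subst; auto.
    + intros z Hz; apply Hc, Hz.
    + intros x y Hx Hy Hyx; apply Hc; split; [| exact Hy].
      exact (proj1 Ha x Hx y Hyx).
  - destruct (ordinal_initial_segment (a := b) (c := c)) as [Ecb | Hcb].
    + exact Hb.
    + intros z Hz; apply Hc, Hz.
    + intros x y Hx Hy Hyx; apply Hc; split; [| exact Hy].
      exact (proj1 Ha x (proj1 (proj1 (Hc x) Hx)) y Hyx).
    + subst; auto.
    + exfalso; apply (proj1 (proj2 Ha) c Hca), Hc; auto.
Qed.

(** Foundation yields a minimal element, and trichotomy makes it least. Here [k] may be any set of
    ordinals. *)
Lemma ordinal_least k (P : (nat -> V) -> Prop) (e : nat -> V) :
  (forall a, a ∈ k -> ordinal a) -> definable P ->
  (exists a, a ∈ k /\ P (scons a e)) ->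
  exists a, a ∈ k /\ P (scons a e) /\
    forall b, b ∈ k -> P (scons b e) -> a = b \/ a ∈ b.
Proof.
  intros Hk HP (a0 & Ha0 & HPa0).
  destruct (separation e k HP) as [D HD].
  destruct (zf_foundation HV (X := D)) as (a & Ha & Hmin).
  { intro HDe; apply (HDe a0), HD; split; assumption. }
  apply HD in Ha; destruct Ha as [Hak HPa]; exists a; repeat split; auto.
  intros b Hb HPb.
  destruct (ordinal_trichotomy (Hk a Hak) (Hk b Hb)) as [H | [H | H]]; auto.
  exfalso; apply (Hmin b); [apply HD; auto | exact H].
Qed.

Lemma ordinal_mem_asym a b : ordinal a -> a ∈ b -> ~ b ∈ a.
Proof.
  intros (Htr & Hirr & _) Hab Hba.
  exact (Hirr a (Htr b Hba a Hab) (Htr b Hba a Hab)).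
Qed.

(** * Absoluteness for transitive sets *)

Lemma submodel_upair M (p x y : submodel M) :
  transitive M ->
  is_upair p x y <-> is_upair (proj1_sig p) (proj1_sig x) (proj1_sig y).
Proof.
  intro HM; split; intros H z.
  - split.
    + intro Hz.
      destruct (proj1 (H (exist _ z (HM _ (proj2_sig p) z Hz))) Hz) as [<- | <-];
        auto.
    + intros [-> | ->]; [apply (H x) | apply (H y)]; auto.
  - change (z ∈ p) with (proj1_sig z ∈ proj1_sig p); rewrite (H (proj1_sig z)).
    split; intros [E | E]; (left + right); solve
      [ subst; reflexivity
      | destruct z as [z Hz], x as [x Hx], y as [y Hy]; simpl in E; subst;
        (* Elements of [submodel M] carry membership proofs, so equality of underlying sets lifts
           only up to those proofs. *)
        f_equal; apply proof_irrelevance ].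
Qed.

Lemma submodel_opair M (p x y : submodel M) :
  transitive M ->
  is_opair p x y <-> is_opair (proj1_sig p) (proj1_sig x) (proj1_sig y).
Proof.
  intro HM; split.
  - intros (a & b & Ha & Hb & Hp); exists (proj1_sig a), (proj1_sig b).
    repeat split; apply submodel_upair; auto.
  - intros (a & b & Ha & Hb & Hp).
    assert (HaM : a ∈ M) by (apply (HM _ (proj2_sig p)), Hp; auto).
    assert (HbM : b ∈ M) by (apply (HM _ (proj2_sig p)), Hp; auto).
    exists (exist _ a HaM), (exist _ b HbM).
    repeat split; apply submodel_upair; auto.
Qed.

Lemma submodel_maps M (f x y : submodel M) :
  transitive M ->
  maps f x y <-> maps (proj1_sig f) (proj1_sig x) (proj1_sig y).
Proof.
  intro HM; split.
  - intros (p & Hp & H); exists (proj1_sig p); split; [exact Hp |].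
    apply submodel_opair; auto.
  - intros (p & Hp & H); exists (exist _ p (HM _ (proj2_sig f) p Hp)).
    split; [exact Hp |]; apply submodel_opair; auto.
Qed.

Lemma submodel_surj M (f X Y : submodel M) :
  transitive M ->
  is_surj f X Y -> is_surj (proj1_sig f) (proj1_sig X) (proj1_sig Y).
Proof.
  intros HM [[Hf Hfun] Hsurj]; repeat split.
  - intros p Hp.
    destruct (Hf (exist _ p (HM _ (proj2_sig f) p Hp)) Hp) as (x & y & Hx & Hy & H).
    exists (proj1_sig x), (proj1_sig y); repeat split; auto.
    exact (proj1 (submodel_opair _ _ _ HM) H).
  - intros x Hx.
    destruct (Hfun (exist _ x (HM _ (proj2_sig X) x Hx)) Hx) as (y & Hy & Huniq).
    exists (proj1_sig y); split; [exact (proj1 (submodel_maps _ _ _ HM) Hy) |].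
    (* Uniqueness must hold against every value in [V]. Such a value is a component of a pair in
       [f], so transitivity puts it in [M], where uniqueness is known. *)
    intros z Hz; pose proof Hz as (p & Hp & Hxz).
    destruct (opair_components_mem HM (HM _ (proj2_sig f) p Hp) Hxz) as [_ HzM].
    rewrite (Huniq (exist _ z HzM)); [reflexivity |].
    apply submodel_maps; auto.
  - intros y Hy.
    destruct (Hsurj (exist _ y (HM _ (proj2_sig Y) y Hy)) Hy) as (x & Hx & H).
    exists (proj1_sig x); split; [exact Hx |].
    exact (proj1 (submodel_maps _ _ _ HM) H).
Qed.

(** * Strong regularity and [H_X] *)

Lemma maximal_cardinality_in_H M X Y :
  transitive M -> transitively_closed M -> closed_under_subsets M ->
  maximal_cardinality M X -> Y ∈ M -> in_H X Y.
Proof.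
  intros HM Htc Hsub [XM HX] HY.
  destruct (Htc Y HY) as (Z & HZ & HZM & _ & HYZ).
  destruct (zf_pairing HV Y Y) as [s Hs].
  destruct (@tc_exists s Z HZ) as (T & HT & HTZ).
  { intros z Hz; apply Hs in Hz; destruct Hz as [-> | ->]; exact HYZ. }
  pose proof (Hsub Z HZM T HTZ) as HTM.
  destruct (HX (exist _ T HTM)) as [HTe | [f Hf]].
  (* The empty alternative of [lesssim] is excluded by [Y ∈ T]. *)
  - exfalso; apply (HTe (exist _ Y HY)); simpl.
    apply (proj1 HT), Hs; auto.
  - exists s, T, (proj1_sig f).
    split; [exact Hs |]; split; [exact HT | exact (submodel_surj HM Hf)].
Qed.

(** A collection principle: a subset of [M] covered by values of a function on a set in [M] is
    itself in [M]. Values of [f] may fall outside [y] and [M], as they do when [f] enumerates a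
    whole transitive closure. *)
Lemma strongly_regular_collects M k S X f y :
  is_ord_cap k M -> strongly_regular M -> closed_under_subsets M ->
  is_fun S k M ->
  (forall a b A B, a ∈ b -> maps S a A -> maps S b B -> subset A B) ->
  (forall x, x ∈ M <-> exists a A, a ∈ k /\ maps S a A /\ x ∈ A) ->
  X ∈ M ->
  (forall t, t ∈ y -> exists x, x ∈ X /\ maps f x t) ->
  (forall x t t', x ∈ X -> maps f x t -> maps f x t' -> t = t') ->
  subset y M -> y ∈ M.
Proof.
  intros Hk (k' & Hk' & Hreg) Hsub HS Hinc HMS HX Hsurj Huniq HyM.
  assert (k' = k) as ->.
  { apply (zf_extensionality HV); intro z; rewrite (Hk' z), (Hk z); reflexivity. }
  (* Restricting to the points that [f] sends into [y] makes the index function total, and its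
     domain stays in [M] by closure under subsets. *)
  destruct (separation (P := fun e => exists t, maps (e 1) (e 0) t /\ t ∈ e 2)
    (scons f (fun _ => y)) X) as [X' HX']; [prove_definable |]; simpl in HX'.
  assert (HX'M : X' ∈ M) by (apply (Hsub X HX); intros z Hz; apply HX', Hz).
  pose (index a t := exists A, maps S a A /\ t ∈ A).
  pose (least a t := a ∈ k /\ index a t /\
    forall b, b ∈ k -> index b t -> a = b \/ a ∈ b).
  assert (Hleast : forall t, t ∈ y -> exists a, least a t).
  { intros t Ht.
    apply (ordinal_least (k := k)
      (P := fun e => exists A, maps (e 1) (e 0) A /\ e 2 ∈ A)
      (e := scons S (fun _ => t))).
    - intros a Ha; apply Hk, Ha.
    - prove_definable.
    - destruct (proj1 (HMS t) (HyM t Ht)) as (a & A & Ha & HA & HtA).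
      exists a; split; [exact Ha |]; exists A; auto. }
  assert (Hleast_unique : forall a b t, least a t -> least b t -> a = b).
  { intros a b t (Ha & Ia & La) (Hb & Ib & Lb).
    destruct (La b Hb Ib) as [| Hab]; [assumption |].
    destruct (Lb a Ha Ia) as [| Hba]; [auto |].
    exfalso; exact (ordinal_mem_asym (proj1 (proj1 (Hk a) Ha)) Hab Hba). }
  (* The graph [g] of the least-index function. Variables 0 and 1 are the argument and the pair; 2
     to 5 are [f], [y], [k], [S]. The formula spells out [least] so that definability can be read
     off. *)
  destruct (replacement
    (P := fun e => exists t a, maps (e 2) (e 0) t /\ t ∈ e 3 /\
       is_opair (e 1) (e 0) a /\ a ∈ e 4 /\
       (exists A, maps (e 5) a A /\ t ∈ A) /\
       (forall b, b ∈ e 4 -> (exists B, maps (e 5) b B /\ t ∈ B) ->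
          a = b \/ a ∈ b))
    (e := scons f (scons y (scons k (fun _ => S)))) (X := X')) as [g Hg].
  - prove_definable.
  - simpl; intros x p q Hx (t & a & Hft & Ht & Hp & Ha) (t' & a' & Hft' & Ht' & Hq & Ha').
    apply HX' in Hx; destruct Hx as [Hx _].
    assert (t' = t) as -> by exact (Huniq x t' t Hx Hft' Hft).
    assert (a' = a) as -> by exact (Hleast_unique a' a t Ha' Ha).
    exact (opair_unique Hp Hq).
  - simpl in Hg.
    assert (Hmaps : forall x a, maps g x a <->
      x ∈ X' /\ exists t, maps f x t /\ t ∈ y /\ least a t).
    { intros x a; split.
      - intros (p & Hp & Hxa); apply Hg in Hp.
        destruct Hp as (x' & Hx' & t & a' & Hft & Ht & Hp & Ha).
        destruct (opair_inj Hxa Hp) as [-> ->].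
        split; [exact Hx' |]; exists t; auto.
      - intros (Hx & t & Hft & Ht & Ha).
        destruct (opair_exists x a) as [p Hp]; exists p; split; [| exact Hp].
        apply Hg; exists x; split; [exact Hx |]; exists t, a; auto. }
    assert (Hgfun : is_fun g X' k).
    { split.
      - intros p Hp; apply Hg in Hp.
        destruct Hp as (x & Hx & t & a & _ & _ & Hp & Ha & _).
        exists x, a; auto.
      - intros x Hx; pose proof (proj1 (HX' x) Hx) as [HxX [t [Hft Ht]]].
        destruct (Hleast t Ht) as [a Ha]; exists a; split.
        + apply Hmaps; split; [exact Hx |]; exists t; auto.
        + intros b Hb; apply Hmaps in Hb; destruct Hb as (_ & t' & Hft' & _ & Hb).
          assert (t' = t) as -> by exact (Huniq x t' t HxX Hft' Hft).
          exact (Hleast_unique a b t Ha Hb). }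
    destruct (Hreg X' g HX'M Hgfun) as (b & Hb & Hbound).
    (* [B] is the level indexed by the bound [b]. It belongs to [M], so it remains to show that [y]
       is a subset of [B]. *)
    destruct (proj2 HS b Hb) as (B & HB & _).
    apply (Hsub B (proj2 (maps_mem HS HB))); intros t Ht.
    destruct (Hsurj t Ht) as (x & Hx & Hft), (Hleast t Ht) as [a Ha].
    assert (Hx' : x ∈ X') by (apply HX'; split; [exact Hx |]; exists t; auto).
    assert (Hga : maps g x a) by (apply Hmaps; split; [exact Hx' |]; exists t; auto).
    destruct Ha as (_ & (A & HA & HtA) & _).
    (* The bound is non-strict: below [b] the levels increase, and at [b] the two levels
       coincide. *)
    destruct (Hbound x a Hx' Hga) as [Hab | ->].
    + exact (Hinc a b A B Hab HA HB t HtA).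
    + rewrite (maps_unique HS HB HA); exact HtA.
Qed.

Lemma in_H_mem M X Y :
  closed_under_subsets M -> hierarchical M -> strongly_regular M ->
  X ∈ M -> in_H X Y -> Y ∈ M.
Proof.
  intros Hsub (_ & k & S & Hk & HS & _ & Hinc & _ & HMS) Hreg HX
    (s & T & f & Hs & (HsT & HT & _) & Hf & Hsurj).
  (* [D] is [T \ M]. Members of a minimal [y ∈ D] stay in [T] by transitivity, hence lie in [M] by
     minimality. *)
  destruct (separation (P := fun e => ~ (e 0 ∈ e 1)) (fun _ => M) T) as [D HD];
    [prove_definable |]; simpl in HD.
  apply NNPP; intro HY.
  destruct (zf_foundation HV (X := D)) as (y & Hy & Hmin).
  { intro HDe; apply (HDe Y), HD; split; [apply HsT, Hs; auto | exact HY]. }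
  apply HD in Hy; destruct Hy as [HyT HyM]; apply HyM.
  apply (strongly_regular_collects (k := k) (S := S) (X := X) (f := f)); auto.
  - intros t Ht; apply Hsurj, (HT y HyT t Ht).
  - intros x t t' _; apply (maps_unique Hf).
  - intros t Ht; apply NNPP; intro HtM; refine (Hmin t _ Ht).
    apply HD; split; [exact (HT y HyT t Ht) | exact HtM].
Qed.

End Model.

Theorem theorem4p10 (V : structure) (HV : ZF V) (M X : V)
  (HM : H_like M) (HX : maximal_cardinality M X) :
  forall Y : V, Y ∈ M <-> in_H X Y.
Proof.
  destruct HM as (Htr & (Htc & _ & Hsub) & Hh & Hreg); intro Y; split.
  - apply (maximal_cardinality_in_H HV); assumption.
  (* [X] itself witnesses that [M] is of successor type, which releases strong regularity. *)
  - apply (in_H_mem HV Hsub Hh); [apply Hreg; exists X; exact HX |].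
    destruct HX as [XM _]; exact XM.
Qed.
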